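(* Let $\phi$ be the Hellinger divergence function, $\phi(x)=(\sqrt x-1)^2$ for $x\ge0$ and $\phi(x)=+\infty$ for $x<0$, and let $\tau>0$. Obtaining an $\epsilon$-accurate estimate of $\mathcal R(X)$ can require an arbitrarily large number of samples, in the following sense: there exist a measurable space $(\Omega,\mathcal F)$, a bounded measurable $X:\Omega\to\mathbb R$ and $\epsilon_0>0$ such that for every $\epsilon\in(0,\epsilon_0)$, every positive integer $n$, and every $\mathcal F^{\otimes n}$-measurable estimator $\hat{\mathcal R}_n:\Omega^n\to\mathbb R$, there is a probability measure $P$ on $(\Omega,\mathcal F)$ with $$P^{\otimes n}\big(|\hat{\mathcal R}_n-\mathcal R^P(X)|>\epsilon\big)\ge\tfrac14 .$$
   Context: For a probability measure $P$ on $(\Omega,\mathcal F)$ and bounded measurable $X$, $$\mathcal R^P(X)=\sup\Big\{\int_\Omega X\zeta\,dP:\ \zeta\ge 0 \text{ measurable},\ \int_\Omega\zeta\,dP=1,\ \int_\Omega\phi(\zeta)\,dP\le\tau\Big\}$$ (in particular only measures absolutely continuous with respect to $P$ are considered). The estimator is a function of $n$ i.i.d. samples from $P$ (and may use knowledge of $\Omega,\mathcal F,X,\phi,\tau$). *)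

(* Defs.v *)
From HB Require Import structures.
From mathcomp Require Import all_boot all_order all_algebra.
From mathcomp Require Import all_classical all_reals all_analysis.

Set Implicit Arguments.
Unset Strict Implicit.
Unset Printing Implicit Defensive.

Import Order.TTheory GRing.Theory Num.Theory.
Import numFieldNormedType.Exports.

Local Open Scope classical_set_scope.
Local Open Scope ring_scope.

Section product_power.
Context d (T : measurableType d) (R : realType).

Definition tuple_cons n (p : T * n.-tuple T) : n.+1.-tuple T :=
  [the n.+1.-tuple T of p.1 :: p.2].

Lemma measurable_tuple_cons n : measurable_fun setT (@tuple_cons n).
Proof. exact: (measurable_cons measurable_fst measurable_snd). Qed.

HB.instance Definition _ n := isMeasurableFun.Build _ _ _ _
  (@tuple_cons n) (@measurable_tuple_cons n).

Variable P : probability T R.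

(* The n-fold product measure of P, on the product sigma-algebra that the
   library puts on n.-tuple T; [product_power_box] characterizes it. *)
Fixpoint product_power n : probability (n.-tuple T) R :=
  match n with
  | 0 => \d_ ([tuple] : 0.-tuple T)
  | m.+1 => distribution (P \x product_power m)%E (@tuple_cons m)
  end.

Lemma product_power_box n (A : 'I_n -> set T) :
  (forall i, measurable (A i)) ->
  product_power n [set w | forall i, A i (tnth w i)] = (\prod_(i < n) P (A i))%E.
Proof.
elim: n A => [|n IHn] A mA.
  by rewrite big_ord0 /= diracE mem_set//= => -[].
pose B := [set w : n.-tuple T | forall i, A (lift ord0 i) (tnth w i)].
have mB : measurable B.
  rewrite (_ : B = \bigcap_(i in [set: 'I_n])
      ((fun w => tnth w i) @^-1` A (lift ord0 i))); last first.
    by apply/seteqP; split => w /= Bw i; [move=> _; exact: Bw|exact: Bw].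
  apply: fin_bigcap_measurable; first exact: finite_finset.
  move=> i _; rewrite -[X in measurable X]setTI.
  exact: (@measurable_tnth _ T n i).
rewrite big_ord_recl -IHn; last by [].
rewrite -(product_measure1E P (product_power n) (mA ord0) mB).
rewrite /= /distribution /pushforward; congr ((_ \x _)%E _).
apply/seteqP; split => -[x w] /=.
  move=> Aw; split => [|i /=]; first by have := Aw ord0.
  by have := Aw (lift ord0 i); rewrite /tuple_cons tnthS.
move=> [Ax Bw] i; have [j ->|->//] := unliftP ord0 i.
by rewrite /tuple_cons tnthS; exact: Bw.
Qed.

End product_power.

Section divergence_risk.
Context d (T : measurableType d) (R : realType).
Variables (phi : R -> \bar R) (tau : R) (P : probability T R).
Local Open Scope ereal_scope.

Definition admissible_density : set (T -> R) :=
  [set zeta : T -> R | [/\ measurable_fun setT zeta,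
                  forall w, (0 <= zeta w)%R,
                  \int[P]_w (zeta w)%:E = 1
                & \int[P]_w phi (zeta w) <= tau%:E]].

Definition divergence_risk (X : T -> R) : \bar R :=
  ereal_sup [set \int[P]_w (X w * zeta w)%:E | zeta in admissible_density].

End divergence_risk.

Definition hellinger (R : realType) (x : R) : \bar R :=
  if 0 <= x then (((Num.sqrt x - 1) ^+ 2)%:E)%E else +oo%E.

(* Main.v *)
Require Import Defs.
From mathcomp Require Import all_boot all_order all_algebra.
From mathcomp Require Import ring lra.
From mathcomp Require Import all_classical all_reals all_analysis.
From mathcomp Require Import measurable_realfun.

Import Order.TTheory GRing.Theory Num.Theory.
Import numFieldNormedType.Exports.

Local Open Scope classical_set_scope.
Local Open Scope ring_scope.

(** Take [Omega = bool] and [X] the indicator of [true].  The risk of [X]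
    vanishes under the Dirac mass at [false], but it is at least
    [q = min(tau, 1) / 2] under a Bernoulli law with any parameter
    [0 < p <= q]: the Bernoulli law of parameter [q] is within Hellinger
    divergence [2 q <= tau] of it, uniformly in [p].  For [p = q / n] the
    all-[false] sample has probability at least [1/2] under the second law (and
    [1] under the first), and the value of the estimator at this single sample
    cannot be close to both risks. *)

Section hellinger_bounds.
Context {R : realType}.
Implicit Type x : R.

Lemma hellingerE x : 0 <= x -> hellinger x = ((Num.sqrt x - 1) ^+ 2)%:E.
Proof. by rewrite /hellinger => ->. Qed.

Lemma hellinger_ge0 x : (0 <= hellinger x)%E.
Proof. by rewrite /hellinger; case: ifP => // _; rewrite lee_fin sqr_ge0. Qed.

Lemma hellinger1 : hellinger (1 : R) = 0%E.
Proof. by rewrite hellingerE// sqrtr1 subrr expr0n. Qed.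

(** With [s = sqrt x >= 1], [0 <= s - 1 <= s]. Linear growth keeps the divergence bounded when the
    density [q / p] blows up. *)
Lemma hellinger_le_id x : 1 <= x -> (hellinger x <= x%:E)%E.
Proof.
move=> x1; have x0 : 0 <= x by exact: le_trans x1.
rewrite hellingerE// lee_fin -[leRHS]sqr_sqrtr//.
have : 1 <= Num.sqrt x by rewrite -[leLHS]sqrtr1 ler_wsqrtr.
nra.
Qed.

(** With [s = sqrt x <= 1], [(1 - s)^2 <= (1 - s)(1 + s) = 1 - x]. *)
Lemma hellinger_le_onem x : 0 <= x <= 1 -> (hellinger x <= (1 - x)%:E)%E.
Proof.
move=> /andP[x0 x1].
rewrite hellingerE// lee_fin -[in leRHS](sqr_sqrtr x0).
have : Num.sqrt x <= 1 by rewrite -[leRHS]sqrtr1 ler_wsqrtr.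
have := sqrtr_ge0 x.
nra.
Qed.

End hellinger_bounds.

Lemma bernoulli_inequality {R : realDomainType} (x : R) (n : nat) :
  0 <= x <= 1 -> 1 - x *+ n <= (1 - x) ^+ n.
Proof.
move=> /andP[x0 x1]; elim: n => [|n IHn]; first by rewrite mulr0n subr0.
have xn0 : 0 <= x *+ n by rewrite mulrn_wge0.
rewrite exprS mulrS (le_trans _ (ler_wpM2l _ IHn)) ?subr_ge0//.
nra.
Qed.

Section bernoulli_risk.
Context {R : realType}.
Implicit Types p q tau : R.

Definition indic_true (b : bool) : R := b%:R.

Lemma divergence_risk_bernoulli0 tau : 0 <= tau ->
  divergence_risk (@hellinger R) tau (bernoulli_prob 0) indic_true = 0%E.
Proof.
move=> tau0; have z01 : 0 <= (0 : R) <= 1 by rewrite lexx ler01.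
have int0 (z : bool -> R) : (forall b, 0 <= z b) ->
    (\int[bernoulli_prob 0]_b (indic_true b * z b)%:E = 0)%E.
  move=> z0; rewrite integral_bernoulli_prob//.
    by rewrite mul0e mul0r mule0 adde0.
  by move=> b; rewrite lee_fin mulr_ge0.
rewrite /divergence_risk (_ : image _ _ = [set 0%E]) ?ereal_sup1//.
apply/seteqP; split => [_ [z [_ z0 _ _] <-]|_ ->] /=; first exact: int0.
(* The constant density has zero divergence, so the supremum is over a nonempty set and is not
   [-oo]. *)
exists (cst 1); last exact: int0.
split => //=.
- by rewrite integral_bernoulli_prob// /unstable.onem subr0 mul0e mul1e add0e.
- by rewrite hellinger1 integral0.
Qed.

Lemma divergence_risk_bernoulli_ge p q tau :
  0 < p -> p <= q -> q < 1 -> 2 * q <= tau ->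
  (q%:E <= divergence_risk (@hellinger R) tau (bernoulli_prob p) indic_true)%E.
Proof.
move=> p0 pq q1 qtau.
have p1 : p < 1 by exact: le_lt_trans q1.
have p01 : 0 <= p <= 1 by rewrite !ltW.
have q0 : 0 < q by exact: lt_le_trans pq.
(* The density of the Bernoulli law of parameter [q] with respect to that of parameter [p]. *)
pose z (b : bool) := if b then q / p else (1 - q) / (1 - p).
have z0 b : 0 <= z b.
  by rewrite /z; case: b; rewrite divr_ge0// ?subr_ge0 ltW.
apply: ereal_sup_ubound; exists z; last first.
  rewrite integral_bernoulli_prob//; last by move=> b; rewrite lee_fin mulr_ge0.
  rewrite /indic_true/= mul0r mule0 adde0 mul1r -EFinM mulrCA.
  by rewrite divff ?mulr1// gt_eqF.
have p'0 : 1 - p != 0 by rewrite subr_eq0 gt_eqF.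
split => //.
- rewrite integral_bernoulli_prob// /z -!EFinM -EFinD /unstable.onem; congr EFin.
  by field; rewrite p'0 gt_eqF.
- rewrite integral_bernoulli_prob; [|by []|by move=> b; exact: hellinger_ge0].
  have zt : (hellinger (z true) <= (z true)%:E)%E.
    by apply: hellinger_le_id; rewrite /z ler_pdivlMr// mul1r.
  have zf : (hellinger (z false) <= (1 - z false)%:E)%E.
    apply: hellinger_le_onem; rewrite z0/= ler_pdivrMr ?subr_gt0// mul1r.
    by rewrite lerD2l lerN2.
  (* The divergence is at most [p * (q / p) + (1 - p) * (1 - (1 - q) / (1 - p)) = q + (q - p)]. *)
  apply: (le_trans (leeD (lee_wpmul2l _ zt) (lee_wpmul2l _ zf))).
  + by rewrite lee_fin ltW.
  + by rewrite lee_fin subr_ge0 ltW.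
  rewrite /z -!EFinM -EFinD lee_fin /unstable.onem.
  rewrite (_ : _ + _ = 2 * q - p); first lra.
  by field; rewrite p'0 gt_eqF.
Qed.

End bernoulli_risk.

Section single_sample_event.
Context {d} {T : measurableType d} {R : realType}.
Local Open Scope ereal_scope.

(** The constant sample is the box with all sides [[set x]], and [A] contains it. *)
Lemma product_power_ge_nseq (P : probability T R) n (x : T)
    (A : set (n.-tuple T)) : measurable [set x] -> measurable A ->
  A [tuple of nseq n x] -> P [set x] ^+ n <= product_power P n A.
Proof.
move=> mx mA Ax.
have := product_power_box P (fun _ : 'I_n => mx).
set B := [set w | _] => PB.
have BE : B = [set [tuple of nseq n x]].
  apply/seteqP; split => [w Bw|_ ->] /=.
    by apply: eq_from_tnth => i; rewrite Bw tnth_nseq.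
  by move=> i; rewrite tnth_nseq.
have mB : measurable B.
  rewrite (_ : B = \bigcap_(i in [set: 'I_n])
      ((fun w => tnth w i) @^-1` [set x])); last first.
    by apply/seteqP; split => w /= Bw i; [move=> _; exact: Bw|exact: Bw].
  apply: fin_bigcap_measurable; first exact: finite_finset.
  move=> i _; rewrite -[X in measurable X]setTI.
  exact: (@measurable_tnth _ T n i).
have <- : product_power P n B = P [set x] ^+ n.
  by rewrite PB big_const card_ord iter_mule mule1.
by apply: le_measure; rewrite ?inE// BE => _ ->.
Qed.

Lemma measurable_far (f : T -> R) (eps : R) (c : \bar R) :
  measurable_fun setT f -> measurable [set w | eps%:E < `|(f w)%:E - c|].
Proof.
move=> mf; rewrite -[X in measurable X]setTI.
apply: emeasurable_fun_o_infty => //; apply: measurableT_comp => //.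
by apply: emeasurable_funB => //; exact/measurable_EFinP.
Qed.

End single_sample_event.

Theorem corollary4p5 (R : realType) (tau : R) (tau_gt0 : 0 < tau) :
  exists (d : measure_display) (Omega : measurableType d) (X : Omega -> R)
         (eps0 : R),
    [/\ measurable_fun [set: Omega] X,
        [bounded X w | w in [set: Omega]],
        0 < eps0
      & forall eps : R, 0 < eps -> eps < eps0 ->
        forall n : nat, (0 < n)%N ->
        forall Rhat : n.-tuple Omega -> R,
          measurable_fun [set: n.-tuple Omega] Rhat ->
        exists P : probability Omega R,
          ((4^-1)%:E <=
           product_power P n
             [set w | eps%:E <
                      `| (Rhat w)%:E - divergence_risk (@hellinger R) tau P X |])%E].
Proof.
pose q := Num.min tau 1 / 2.
have q0 : 0 < q by rewrite divr_gt0// lt_min tau_gt0 ltr01.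
have qtau : 2 * q <= tau by rewrite mulrC divfK// ge_min lexx.
have q1 : 2 * q <= 1 by rewrite mulrC divfK// ge_min lexx orbT.
(* The two risks are at least [q > 2 * eps] apart, so no real number is within [eps] of both. *)
exists _, bool, indic_true, (q / 2); split => //.
- exists 1; split => // M /ltW M1 [] _ /=; rewrite ?normr1 ?normr0//.
  exact: le_trans M1.
- by rewrite divr_gt0.
move=> eps eps0 epsq n n0 Rhat mRhat.
have sample_bound (p : R) (p01 : 0 <= p <= 1) (c : \bar R) :
    (eps%:E < `|(Rhat [tuple of nseq n false])%:E - c|)%E ->
    (((1 - p) ^+ n)%:E <= product_power (bernoulli_prob p) n
      [set w | eps%:E < `|(Rhat w)%:E - c|])%E.
  move=> far; apply: le_trans (product_power_ge_nseq _ _ _ _ _ _ far) => //.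
    rewrite /= bernoulli_probE// !diracE memNset//= mem_set//= mule0 add0e mule1.
    by rewrite EFin_expe.
  exact: measurable_far.
(* An estimate far from [0] fails for the Dirac mass at [false]; an estimate near [0] fails for a
   small positive parameter. *)
have [far|near] := ltP eps `|Rhat [tuple of nseq n false]|.
  exists (bernoulli_prob 0); rewrite (divergence_risk_bernoulli0 tau (ltW tau_gt0)).
  have z01 : 0 <= (0 : R) <= 1 by rewrite lexx ler01.
  apply: le_trans (sample_bound 0 z01 0%E _); last by rewrite sube0.
  by rewrite subr0 expr1n lee_fin invf_le1 ?ler1n.
pose p := q / n%:R.
have nR : 1 <= n%:R :> R by rewrite ler1n.
have nR0 : 0 < n%:R :> R by rewrite ltr0n.
have p0 : 0 < p by rewrite divr_gt0.
have pq : p <= q by rewrite ler_pdivrMr// ler_peMr// ltW.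
have p01 : 0 <= p <= 1 by rewrite ltW//=; lra.
exists (bernoulli_prob p).
apply: le_trans (sample_bound p p01 _ _).
  (* [(1 - p) ^+ n >= 1 - n * p = 1 - q >= 1/2], since [2 * q <= 1]. *)
  rewrite lee_fin; apply: le_trans (bernoulli_inequality _ _ p01).
  rewrite -[p *+ n]mulr_natr /p divfK ?gt_eqF//; lra.
have q_lt1 : q < 1 by lra.
have := divergence_risk_bernoulli_ge p q tau p0 pq q_lt1 qtau.
(* The lower bound [q] rules out [-oo], and at [+oo] the distance is infinite. For a finite risk
   [r], [r - Rhat >= q - eps > eps]. *)
case: (divergence_risk _ _ _ _) => [r| |] //=; last by rewrite ltry.
rewrite !lee_fin lte_fin => qr.
have := ler_norm (Rhat [tuple of nseq n false]).
rewrite distrC => ?; apply: lt_le_trans (ler_norm _); lra.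
Qed.
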